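(* Suppose that we have a $k$-th order system of two rational difference equations $$x_n=\frac{\alpha+\sum^{k}_{i=1}\beta_{i}x_{n-i} + \sum^{k}_{i=1}\gamma_{i}y_{n-i}}{A+\sum^{k}_{j=1}B_{j}x_{n-j} + \sum^{k}_{j=1}C_{j}y_{n-j}},\qquad y_n=\frac{p+\sum^{k}_{i=1}\delta_{i}x_{n-i} + \sum^{k}_{i=1}\epsilon_{i}y_{n-i}}{q+\sum^{k}_{j=1}D_{j}x_{n-j} + \sum^{k}_{j=1}E_{j}y_{n-j}},\qquad n\in\mathbb{N},$$ with non-negative parameters and non-negative initial conditions. Further assume that there exist $M_1,M_3>0$ and $M_4>M_2>0$ so that $x_n\le M_1y_n+M_2\le M_3x_n+M_4$ for all $n\in\mathbb{N}$, and suppose that $q=0$ and one of the following holds: (i) $I_B\cup I_C\subseteq I_\beta\cup I_\gamma$, $\alpha>0$, and $I_D\neq\emptyset$; (ii) $I_D\cup I_E\subseteq I_\delta\cup I_\epsilon$, $p>0$, and $I_E\neq\emptyset$; and that there exists a positive integer $\eta$ such that for every sequence $\{c_m\}_{m=1}^\infty$ with $c_m\in I_\delta\cup I_\epsilon$ for $m=1,2,\dots$ there exist positive integers $N_1,N_2\le\eta$ such that $\sum_{m=N_1}^{N_2}c_m\in I_D\cup I_E$. Then there exist $M>0$ and $N\in\mathbb{N}$ so that, given any non-negative initial conditions, we have $x_n,y_n\le M$ for all $n>N$.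
   Context: $\mathbb{N}=\{1,2,\dots\}$ and $k$ is a positive integer. Initial conditions are $x_{1-k},\dots,x_0,y_{1-k},\dots,y_0\ge 0$, taken so that the denominators do not vanish. For each family of coefficients, the index set is the set of indices in $\{1,\dots,k\}$ with positive coefficient: $I_\beta=\{i:\beta_i>0\}$, $I_\gamma=\{i:\gamma_i>0\}$, $I_\delta=\{i:\delta_i>0\}$, $I_\epsilon=\{i:\epsilon_i>0\}$, $I_B=\{j:B_j>0\}$, $I_C=\{j:C_j>0\}$, $I_D=\{j:D_j>0\}$, $I_E=\{j:E_j>0\}$. *)

(* Defs.v *)
From HB Require Import structures.
From mathcomp Require Import all_boot all_order all_algebra.
From mathcomp Require Import boolp classical_sets reals.

Set Implicit Arguments.
Unset Strict Implicit.
Unset Printing Implicit Defensive.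

Import Order.TTheory GRing.Theory Num.Theory.

Local Open Scope classical_set_scope.
Local Open Scope ring_scope.

(* Families of coefficients are functions on nat, of which only the values at
   the indices 1, ..., k are ever used. The fields are, in order, the Greek and
   Latin coefficients alpha, beta_i, gamma_i, A, B_j, C_j of the equation for x
   and p, delta_i, epsilon_i, q, D_j, E_j of the equation for y. *)
Record rational_system (R : realType) := RationalSystem {
  sys_alpha : R;
  sys_beta : nat -> R;
  sys_gamma : nat -> R;
  sys_A : R;
  sys_B : nat -> R;
  sys_C : nat -> R;
  sys_p : R;
  sys_delta : nat -> R;
  sys_epsilon : nat -> R;
  sys_q : R;
  sys_D : nat -> R;
  sys_E : nat -> R
}.

Definition nonneg_family (R : realType) (k : nat) (f : nat -> R) : Prop :=
  forall i : nat, (1 <= i <= k)%N -> 0 <= f i.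

Definition nonneg_parameters (R : realType) (k : nat)
    (sys : rational_system R) : Prop :=
  [/\ 0 <= sys_alpha sys, 0 <= sys_A sys, 0 <= sys_p sys & 0 <= sys_q sys] /\
  [/\ nonneg_family k (sys_beta sys), nonneg_family k (sys_gamma sys),
      nonneg_family k (sys_B sys) & nonneg_family k (sys_C sys)] /\
  [/\ nonneg_family k (sys_delta sys), nonneg_family k (sys_epsilon sys),
      nonneg_family k (sys_D sys) & nonneg_family k (sys_E sys)].

Definition index_set (R : realType) (k : nat) (f : nat -> R) : set nat :=
  [set i | (1 <= i <= k)%N /\ 0 < f i].

(* Sequences are indexed by int, so that the initial values x_{1-k}, ..., x_0
   keep their indices; the values at indices below 1-k are never used. *)
Definition affine_form (R : realType) (k : nat) (a : R) (b c : nat -> R)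
    (x y : int -> R) (n : nat) : R :=
  a + \sum_(1 <= i < k.+1) b i * x (n%:Z - i%:Z)
    + \sum_(1 <= i < k.+1) c i * y (n%:Z - i%:Z).

Definition x_num (R : realType) (k : nat) (sys : rational_system R) :=
  affine_form k (sys_alpha sys) (sys_beta sys) (sys_gamma sys).
Definition x_den (R : realType) (k : nat) (sys : rational_system R) :=
  affine_form k (sys_A sys) (sys_B sys) (sys_C sys).
Definition y_num (R : realType) (k : nat) (sys : rational_system R) :=
  affine_form k (sys_p sys) (sys_delta sys) (sys_epsilon sys).
Definition y_den (R : realType) (k : nat) (sys : rational_system R) :=
  affine_form k (sys_q sys) (sys_D sys) (sys_E sys).

(* Solutions with non-negative initial conditions. Requiring that no
   denominator vanishes is what makes the initial conditions admissible
   (division by zero is total here). *)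
Definition nonneg_solution (R : realType) (k : nat) (sys : rational_system R)
    (x y : int -> R) : Prop :=
  (forall i : nat, (i < k)%N -> 0 <= x (- i%:Z) /\ 0 <= y (- i%:Z)) /\
  (forall n : nat, (1 <= n)%N ->
     [/\ x_den k sys x y n != 0, y_den k sys x y n != 0,
         x n%:Z = x_num k sys x y n / x_den k sys x y n
       & y n%:Z = y_num k sys x y n / y_den k sys x y n]).

(* Main.v *)
(* Since x_n and y_n are comparable up to affine functions, (i) bounds x_n, and
   (ii) bounds y_n, away from 0 for n > k, and with it the denominator of y_n
   for n > 2k. Put w_n = 1 + y_n, F = I_delta U I_epsilon, G = I_D U I_E. If i in
   F maximizes w_{n-i}, then w_n <= C w_{n-i}, and
   y_n w_{n-j} <= C w_{n-i} for every j in G because the denominator of y_n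
   dominates w_{n-j}. Following such lags eta times visits n = t_0 > t_1 > ...,
   and the hypothesis on sums gives a < b <= eta with t_a - t_b in G. Then
   y_{t_a} <= C w_{t_{a+1}} / w_{t_b} <= C^eta, whence w_n <= C^eta (1 + C^eta). *)
Require Import Defs.
From HB Require Import structures.
From mathcomp Require Import all_boot all_order all_algebra.
From mathcomp Require Import boolp classical_sets reals.
From mathcomp Require Import zify ring lra.

Set Implicit Arguments.
Unset Strict Implicit.
Unset Printing Implicit Defensive.

Import Order.TTheory GRing.Theory Num.Theory.

Local Open Scope classical_set_scope.
Local Open Scope ring_scope.


(** * Comparable pairs and domination between affine forms *)

Definition comparable (R : realType) (K s t : R) : Prop :=
  [/\ 0 <= s, 0 <= t, s <= K * (1 + t) & t <= K * (1 + s)].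

Lemma lag_gt0 (k n i : nat) : (k < n)%N -> (1 <= i <= k)%N -> (1 <= n - i)%N.
Proof. lia. Qed.

Lemma comparable_sym (R : realType) (K s t : R) :
  comparable K s t -> comparable K t s.
Proof. by case. Qed.

(** Comparability bounds the left side by [(b' + c' * K) * (1 + s)], and the form on the right
    controls both [1], through [a], and [s], through [b]. *)
Lemma dominated_by_left (R : realType) (K a b c b' c' : R) :
  0 <= K -> 0 < a -> 0 < b -> 0 <= c -> 0 <= b' -> 0 <= c' ->
  exists2 H : R, 0 <= H & forall s t : R, comparable K s t ->
    b' * s + c' * t <= H * (a + b * s + c * t).
Proof.
move=> K0 a0 b0 c0 b'0 c'0; exists ((b' + c' * K) * (a^-1 + b^-1)).
  by rewrite mulr_ge0 ?addr_ge0 ?mulr_ge0 ?invr_ge0 // ltW.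
move=> s t [s0 t0 _ ts].
have ct0 : 0 <= c * t by exact: mulr_ge0.
have bs0 : 0 <= b * s by rewrite mulr_ge0 // ltW.
have le1 : 1 <= a^-1 * (a + b * s + c * t).
  rewrite -(ler_pM2l a0) mulrA divff ?gt_eqF // mul1r mulr1; lra.
have le2 : s <= b^-1 * (a + b * s + c * t).
  rewrite -(ler_pM2l b0) mulrA divff ?gt_eqF // mul1r; lra.
apply: (@le_trans _ _ ((b' + c' * K) * (1 + s))).
  have : c' * t <= c' * (K * (1 + s)) by rewrite ler_wpM2l.
  rewrite mulrA mulrDl; move: b'0; lra.
rewrite -mulrA; apply: ler_wpM2l; first by rewrite addr_ge0 ?mulr_ge0.
by rewrite mulrDl lerD.
Qed.

(** If [b'] and [c'] both vanish, [H = 0] does. Otherwise [b] or [c] is positive, and the symmetry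
    of comparability makes either one sufficient. *)
Lemma dominated (R : realType) (K a b c b' c' : R) :
  0 <= K -> 0 < a -> 0 <= b -> 0 <= c -> 0 <= b' -> 0 <= c' ->
  (0 < b' \/ 0 < c' -> 0 < b \/ 0 < c) ->
  exists2 H : R, 0 <= H & forall s t : R, comparable K s t ->
    b' * s + c' * t <= H * (a + b * s + c * t).
Proof.
move=> K0 a0 b0 c0 b'0 c'0 supp.
have bc : 0 < b \/ 0 < c ->
    exists2 H : R, 0 <= H & forall s t : R, comparable K s t ->
      b' * s + c' * t <= H * (a + b * s + c * t).
  case=> [bp|cp]; first exact: dominated_by_left.
  have [H H0 HP] := dominated_by_left K0 a0 cp b0 c'0 b'0.
  by exists H => // s t /comparable_sym /HP; lra.
have [b'p|b'n] := ltP 0 b'; first by apply/bc/supp; left.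
have [c'p|c'n] := ltP 0 c'; first by apply/bc/supp; right.
exists 0 => // s t _.
have -> : b' = 0 by apply/le_anti/andP.
have -> : c' = 0 by apply/le_anti/andP.
by rewrite !mul0r addr0.
Qed.

Lemma uniform_bound (R : realType) (k : nat) (P : nat -> R -> Prop) :
  (forall i H H', P i H -> H <= H' -> P i H') ->
  (forall i, (1 <= i <= k)%N -> exists2 H : R, 0 <= H & P i H) ->
  exists2 H : R, 0 <= H & forall i, (1 <= i <= k)%N -> P i H.
Proof.
move=> mono; elim: k => [|k IH] ex; first by exists 0 => // i; lia.
have [|H H0 HP] := IH; first by move=> i ik; apply: ex; lia.
have [|H' H'0 H'P] := ex k.+1; first by lia.
exists (H + H') => [|i ik]; first exact: addr_ge0.
have [->|ne] := eqVneq i k.+1; first by apply: mono H'P _; lra.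
by apply: (mono _ H); [apply: HP; lia | lra].
Qed.

(** Only unions of index sets need to be compared: at a given lag, a positive coefficient on one
    variable controls the other variable too. *)
Lemma family_dominated (R : realType) (k : nat) (K a : R)
    (b c b' c' : nat -> R) :
  0 <= K -> 0 < a ->
  nonneg_family k b -> nonneg_family k c ->
  nonneg_family k b' -> nonneg_family k c' ->
  index_set k b' `|` index_set k c' `<=` index_set k b `|` index_set k c ->
  exists2 H : R, 0 <= H & forall i, (1 <= i <= k)%N ->
    forall s t : R, comparable K s t ->
      b' i * s + c' i * t <= H * (a + b i * s + c i * t).
Proof.
move=> K0 a0 b0 c0 b'0 c'0 supp.
have [||H H0 HP] := @uniform_bound R k (fun i H => (1 <= i <= k)%N ->
  forall s t : R, comparable K s t ->
    b' i * s + c' i * t <= H * (a + b i * s + c i * t)); last first.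
- by exists H => // i ik; apply: HP.
- move=> i ik.
  have [||||||//|H H0 HP] := @dominated R K a (b i) (c i) (b' i) (c' i);
    rewrite ?b0 ?c0 ?b'0 ?c'0 //; last by exists H.
  have bc : (index_set k b' `|` index_set k c') i -> 0 < b i \/ 0 < c i.
    by move=> /supp[[_ ?]|[_ ?]]; [left|right].
  by case=> gt0; apply: bc; [left|right].
- move=> i H H' HP HH' ik s t st; apply: le_trans (HP ik s t st) _.
  have [s0 t0 _ _] := st; apply: ler_wpM2r => //.
  by rewrite !addr_ge0 ?mulr_ge0 ?b0 ?c0 // ltW.
Qed.

(** * Affine forms along comparable sequences *)

Section Comparable_sequences.
Variables (R : realType) (k : nat) (K : R) (x y : int -> R).
Hypothesis xy : forall n : nat, (1 <= n)%N -> comparable K (x n%:Z) (y n%:Z).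

(** Beyond [k] all lagged indices are positive, so integer and truncated subtraction agree, and
    merging the sums pairs the values to which [comparable] applies. *)
Lemma affine_formE (a : R) (b c : nat -> R) (n : nat) : (k < n)%N ->
  affine_form k a b c x y n = a + \sum_(1 <= i < k.+1)
    (b i * x (n - i)%N%:Z + c i * y (n - i)%N%:Z).
Proof.
move=> kn; rewrite /affine_form big_split /= addrA.
by congr (_ + _ + _); apply: eq_big_nat => i ik; rewrite subzn //; lia.
Qed.

Lemma affine_form_ge_term (a : R) (b c : nat -> R) (n i : nat) :
  nonneg_family k b -> nonneg_family k c -> (k < n)%N -> (1 <= i <= k)%N ->
  a + b i * x (n - i)%N%:Z + c i * y (n - i)%N%:Z <= affine_form k a b c x y n.
Proof.
move=> b0 c0 kn ik; rewrite affine_formE // -addrA lerD2l.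
rewrite (big_cat_nat (n := i)) /=; [|lia|lia].
rewrite (big_ltn (m := i)); last lia.
rewrite addrCA lerDl addr_ge0 // big_nat_cond sumr_ge0 // => j;
  rewrite andbT => jk; have [|x0 y0 _ _] := xy (n := n - j); try lia;
  by rewrite addr_ge0 // mulr_ge0 // (b0, c0) //; lia.
Qed.

Lemma affine_form_le (a H W : R) (b c : nat -> R) (n : nat) : (k < n)%N ->
  (forall i, (1 <= i <= k)%N ->
    b i * x (n - i)%N%:Z + c i * y (n - i)%N%:Z <= H * W) ->
  affine_form k a b c x y n <= a + H * k%:R * W.
Proof.
move=> kn le; rewrite affine_formE // lerD2l.
have -> : H * k%:R * W = \sum_(1 <= i < k.+1) (H * W).
  by rewrite sumr_const_nat subn1 /= -mulr_natr; ring.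
by apply: ler_sum_nat => i ik; apply: le; lia.
Qed.

End Comparable_sequences.

(** With [W] the dominating form, each of the [k] paired terms is at most [H * W], and
    [a' <= a' / a * W]. The extra [1] makes the constant positive before inversion. [L] is fixed
    before the solution is. *)
Lemma affine_form_ratio_ge (R : realType) (k : nat) (K a a' : R)
    (b c b' c' : nat -> R) :
  0 <= K -> 0 < a -> 0 <= a' ->
  nonneg_family k b -> nonneg_family k c ->
  nonneg_family k b' -> nonneg_family k c' ->
  index_set k b' `|` index_set k c' `<=` index_set k b `|` index_set k c ->
  exists2 L : R, 0 < L & forall x y : int -> R,
    (forall n : nat, (1 <= n)%N -> comparable K (x n%:Z) (y n%:Z)) ->
    forall n : nat, (k < n)%N ->
      L * affine_form k a' b' c' x y n <= affine_form k a b c x y n.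
Proof.
move=> K0 a0 a'0 b0 c0 b'0 c'0 supp.
have [H H0 HP] := family_dominated K0 a0 b0 c0 b'0 c'0 supp.
have G0 : 0 < a' / a + H * k%:R + 1.
  by rewrite ltr_wpDl // addr_ge0 ?mulr_ge0 ?invr_ge0 // ltW.
exists (a' / a + H * k%:R + 1)^-1; first by rewrite invr_gt0.
move=> x y xy n kn; set W := affine_form k a b c x y n.
rewrite mulrC ler_pdivrMr //.
have aW : a <= W.
  rewrite /W affine_formE // lerDl big_nat_cond sumr_ge0 // => j.
  rewrite andbT => jk; have [|x0 y0 _ _] := xy (n - j)%N; first lia.
  by rewrite addr_ge0 // mulr_ge0 // (b0, c0) //; lia.
apply: le_trans (affine_form_le (H := H) (W := W) _ kn _) _.
  move=> i ik; apply: le_trans (HP i ik _ _ (xy _ _)) _; first lia.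
  by apply: ler_wpM2l => //; exact: (affine_form_ge_term xy).
have a'W : a' <= a' / a * W.
  by rewrite -mulrA ler_peMr // mulrC ler_pdivlMr // mul1r.
by move: (a' / a) a'W => q a'W; lra.
Qed.

(** * Iteration of maximizing lags *)

(** The threshold leaves room for [eta] lags of size at most [k], with every visited index still
    above [n0 + k], where the step hypothesis applies. *)
Lemma bounded_by_iteration (R : realType) (k eta n0 : nat) (C : R)
    (F G : set nat) (y : nat -> R) :
  F `<=` [set i | (1 <= i <= k)%N] -> G `<=` [set i | (1 <= i <= k)%N] ->
  F !=set0 -> 1 <= C ->
  (forall c : nat -> nat, (forall m, (1 <= m)%N -> F (c m)) ->
     exists N1 N2 : nat, [/\ (1 <= N1 <= eta)%N, (1 <= N2 <= eta)%N
       & G (\sum_(N1 <= m < N2.+1) c m)%N]) ->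
  (forall n, (n0 < n)%N -> 0 <= y n) ->
  (forall n, (n0 + k < n)%N -> exists i, [/\ F i,
     1 + y n <= C * (1 + y (n - i)%N)
     & forall j, G j -> y n * (1 + y (n - j)%N) <= C * (1 + y (n - i)%N)]) ->
  forall n, (n0 + k * eta.+1 < n)%N ->
    1 + y n <= C ^+ eta * (1 + C ^+ eta).
Proof.
move=> Fk Gk [f0 Ff0] C1 iter y0 step n nn.
(* The hypothesis on sums needs an infinite sequence in [F], so the lag defaults to [f0] at indices
   where the step hypothesis is silent. *)
have /choice [pick pickP] : forall n, exists i, F i /\ ((n0 + k < n)%N ->
     1 + y n <= C * (1 + y (n - i)%N) /\
     forall j, G j -> y n * (1 + y (n - j)%N) <= C * (1 + y (n - i)%N)).
  move=> m; have [/step[i [? ? ?]]|mn] := ltnP (n0 + k) m; first by exists i.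
  by exists f0; split=> //; lia.
(* [t m] is the index reached from [n] after [m] lags [pick]; consecutive lags
   telescope, so the hypothesis yields two visited indices whose difference
   lies in [G]. *)
pose t m := ssrnat.iter m (fun a => a - pick a)%N n.
have pick_k a : (1 <= pick a <= k)%N by apply: Fk; case: (pickP a).
have t_ge m : (n <= t m + k * m)%N.
  elim: m => [|m IH]; first by rewrite /t /=; lia.
  have := pick_k (t m); rewrite /t /= -/(t m) mulnS; lia.
have t_big m : (m <= eta)%N -> (n0 + k < t m)%N.
  move=> me; have := t_ge m; have : (k * m <= k * eta)%N by rewrite leq_mul.
  by move: nn; rewrite mulnS; lia.
have tel a d : (a + d <= eta)%N ->
    t a = (t (a + d) + \sum_(a.+1 <= m < (a + d).+1) pick (t m.-1))%N.
  elim: d => [|d IH] ad; first by rewrite addn0 big_geq ?addn0.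
  rewrite addnS big_nat_recr /=; last lia.
  rewrite IH; last lia.
  have := pick_k (t (a + d)%N); have := t_big (a + d)%N.
  rewrite /t /= -/(t (a + d)%N); lia.
have grow a d : (a + d <= eta)%N -> 1 + y (t a) <= C ^+ d * (1 + y (t (a + d)%N)).
  elim: d => [|d IH] ad; first by rewrite addn0 expr0 mul1r.
  apply: le_trans (IH _) _; first lia.
  rewrite exprSr -mulrA ler_wpM2l ?exprn_ge0 ?(le_trans _ C1) //.
  rewrite addnS; have [_ []//] := pickP (t (a + d)%N); apply: t_big; lia.
(* Sequences start at index 1, so term [m] is the lag leaving [t m.-1]; the sum from [N1] to [N2] is
   then [t N1.-1 - t N2]. *)
have [|N1 [N2 [N1e N2e GN]]] := iter (fun m => pick (t m.-1)).
  by move=> m _; case: (pickP (t m.-1)).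
(* An empty sum would put 0 in [G]. *)
have N12 : (N1 <= N2)%N.
  by rewrite leqNgt; apply/negP => N21; move/Gk: GN; rewrite big_geq.
have C0 : 0 <= C by exact: le_trans C1.
have Cle d : (d <= eta)%N -> C ^+ d <= C ^+ eta.
  by move=> de; apply: ler_weXn2l.
case: N1 N1e GN N12 => [//|a] N1e GN N12.
have ta := tel a (N2 - a)%N; rewrite subnKC in ta; last lia.
have := pickP (t a) => -[_ []]; first by apply: t_big; lia.
move=> _ /(_ _ GN); rewrite [X in (X - _)%N]ta; last lia.
rewrite addnK => yw.
have := grow a.+1 (N2 - a.+1)%N; rewrite subnKC //.
rewrite {1}/t /= -/(t a) => /(_ _) => {}grow1.
have w0 m : (m <= eta)%N -> 0 < 1 + y (t m).
  by move=> me; rewrite ltr_pwDl // y0 // (leq_ltn_trans (leq_addr k n0)) ?t_big.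
(* Here [y (t a) * (1 + y (t N2))] is at most [C * (1 + y (t a.+1))], hence at most
   [C ^+ (N2 - a) * (1 + y (t N2))]; the positive factor cancels. *)
have ya : y (t a) <= C ^+ eta.
  rewrite -(ler_pM2r (w0 N2 _)); last lia.
  apply: le_trans yw _.
  apply: le_trans (ler_wpM2l C0 (grow1 _)) _; first lia.
  rewrite mulrA -exprS; apply: ler_wpM2r; first by apply/ltW/w0; lia.
  by apply: Cle; lia.
(* Growth over the first [a] lags carries the bound at [t a] back to [n]. *)
have := grow 0 a; rewrite add0n {1}/t /= => /(_ _) g0.
apply: le_trans (g0 _) _; first lia.
apply: ler_pM; rewrite ?exprn_ge0 ?lerD2l //; first by apply/ltW/w0; lia.
by apply: Cle; lia.
Qed.

(** * Positivity, comparability and a lower bound for the denominator of [y] *)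

(** By strong induction, a non-negative past makes the denominators non-negative, hence positive
    since they do not vanish. *)
Lemma nonneg_solution_pos (R : realType) (k : nat) (sys : rational_system R)
    (x y : int -> R) :
  nonneg_parameters k sys -> nonneg_solution k sys x y ->
  forall n : nat, (1 <= n)%N ->
    [/\ 0 <= x n%:Z, 0 <= y n%:Z, 0 < x_den k sys x y n & 0 < y_den k sys x y n].
Proof.
move=> [[a0 A0 p0 q0] [[b0 c0 B0 C0] [d0 e0 D0 E0]]] [init rec].
have form0 (a : R) (b c : nat -> R) (n : nat) :
    0 <= a -> nonneg_family k b -> nonneg_family k c -> (1 <= n)%N ->
    (forall m, (1 <= m < n)%N -> 0 <= x m%:Z /\ 0 <= y m%:Z) ->
    0 <= affine_form k a b c x y n.
  move=> a_0 b_0 c_0 n1 IH.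
  have past i : (1 <= i < k.+1)%N -> 0 <= x (n%:Z - i%:Z) /\ 0 <= y (n%:Z - i%:Z).
    move=> ik; have [ni|ni] := ltnP i n.
      by rewrite subzn; [apply: IH; lia | lia].
    (* An initial value is read here; [1 <= n] gives [i - n < k]. *)
    have -> : n%:Z - i%:Z = - (i - n)%N%:Z by lia.
    by apply: init; lia.
  by rewrite /affine_form !addr_ge0 // big_nat_cond sumr_ge0 // => i;
    rewrite andbT => ik; have [? ?] := past i ik; rewrite mulr_ge0 // (b_0, c_0).
elim/ltn_ind=> n IH n1.
have {}IH m : (1 <= m < n)%N -> 0 <= x m%:Z /\ 0 <= y m%:Z.
  by move=> /andP[m1 mn]; have [] := IH m mn m1.
have [xd yd -> ->] := rec n n1.
rewrite ![0 < _]lt_def xd yd.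
by split; rewrite ?divr_ge0 //; apply: form0.
Qed.

(** [M1 + M2] serves the first inequality and [(M3 + M4) / M1] the second; their sum serves both. *)
Lemma comparable_of_affine (R : realType) (M1 M2 M3 M4 s t : R) :
  0 < M1 -> 0 < M2 -> 0 < M3 -> M2 < M4 -> 0 <= s -> 0 <= t ->
  s <= M1 * t + M2 -> M1 * t + M2 <= M3 * s + M4 ->
  comparable (M1 + M2 + (M3 + M4) / M1) s t.
Proof.
move=> M10 M20 M30 M24 s0 t0 st ts.
have Q0 : 0 <= (M3 + M4) / M1 by rewrite divr_ge0 //; lra.
have tQ : t <= (M3 + M4) / M1 * (1 + s).
  by rewrite mulrAC ler_pdivlMr //; nra.
by split=> //; nra.
Qed.

(** In either case the numerator of one unknown dominates its denominator, so that unknown is at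
    least [L] beyond [k]. A lag [j] with positive coefficient brings this into the denominator of
    [y]; [2 * k < n] ensures [k < n - j]. *)
Lemma y_den_lower_bound (R : realType) (k : nat) (sys : rational_system R)
    (K : R) :
  0 <= K -> nonneg_parameters k sys ->
  [/\ index_set k (sys_B sys) `|` index_set k (sys_C sys)
        `<=` index_set k (sys_beta sys) `|` index_set k (sys_gamma sys),
      0 < sys_alpha sys & index_set k (sys_D sys) !=set0]
  \/
  [/\ index_set k (sys_D sys) `|` index_set k (sys_E sys)
        `<=` index_set k (sys_delta sys) `|` index_set k (sys_epsilon sys),
      0 < sys_p sys & index_set k (sys_E sys) !=set0] ->
  exists2 d : R, 0 < d & forall x y : int -> R, nonneg_solution k sys x y ->
    (forall n : nat, (1 <= n)%N -> comparable K (x n%:Z) (y n%:Z)) ->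
    forall n : nat, (2 * k < n)%N -> d <= y_den k sys x y n.
Proof.
move=> K0 par; have [[a0 A0 p0 q0] [[b0 c0 B0 C0] [d0 e0 D0 E0]]] := par.
case=> -[supp pos [j [jk Pj]]].
  have [L L0 LP] := affine_form_ratio_ge K0 pos A0 b0 c0 B0 C0 supp.
  exists (sys_D sys j * L) => [|x y sol xy n kn]; first exact: mulr_gt0.
  have k_n : (k < n)%N by exact: leq_ltn_trans (leq_pmull k _) kn.
  have nj : (k < n - j)%N by move: kn jk; clear; lia.
  have nj1 : (1 <= n - j)%N by exact: lag_gt0 jk.
  have [_ _ xd _] := nonneg_solution_pos par sol nj1.
  have xL : L <= x (n - j)%N%:Z.
    have [_ _ -> _] := sol.2 (n - j)%N nj1.
    by rewrite ler_pdivlMr //; apply: LP.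
  have [_ y0 _ _] := xy (n - j)%N nj1.
  apply: le_trans (affine_form_ge_term xy (sys_q sys) D0 E0 k_n jk).
  have : sys_D sys j * L <= sys_D sys j * x (n - j)%N%:Z by rewrite ler_pM2l.
  have := mulr_ge0 (E0 j jk) y0; lra.
have [L L0 LP] := affine_form_ratio_ge K0 pos q0 d0 e0 D0 E0 supp.
exists (sys_E sys j * L) => [|x y sol xy n kn]; first exact: mulr_gt0.
have k_n : (k < n)%N by exact: leq_ltn_trans (leq_pmull k _) kn.
have nj : (k < n - j)%N by move: kn jk; clear; lia.
have nj1 : (1 <= n - j)%N by exact: lag_gt0 jk.
have [_ _ _ yd] := nonneg_solution_pos par sol nj1.
have yL : L <= y (n - j)%N%:Z.
  have [_ _ _ ->] := sol.2 (n - j)%N nj1.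
  by rewrite ler_pdivlMr //; apply: LP.
have [x0 _ _ _] := xy (n - j)%N nj1.
apply: le_trans (affine_form_ge_term xy (sys_q sys) D0 E0 k_n jk).
have : sys_E sys j * L <= sys_E sys j * y (n - j)%N%:Z by rewrite ler_pM2l.
have := mulr_ge0 (D0 j jk) x0; lra.
Qed.

(** * One growth step for [y] *)

Lemma exists_max_on (R : realType) (k : nat) (F : set nat) (w : nat -> R) :
  F `<=` [set i | (1 <= i <= k)%N] -> F !=set0 ->
  exists2 i, F i & forall j, F j -> w j <= w i.
Proof.
move=> Fk [f Ff].
have fk i : F i -> (i < k.+1)%N by move/Fk => /= /andP[].
have Pf : `[< F (Ordinal (fk f Ff)) >] by apply/asboolP.
case: (arg_maxP (P := fun i : 'I_k.+1 => `[< F i >]) (fun i => w i) Pf) => i /asboolP Fi max.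
by exists i => // j Fj; apply: (max (Ordinal (fk j Fj))); apply/asboolP.
Qed.

Lemma y_growth_step (R : realType) (k : nat) (sys : rational_system R) (K d : R) :
  0 <= K -> 0 < d -> nonneg_parameters k sys ->
  let F := index_set k (sys_delta sys) `|` index_set k (sys_epsilon sys) in
  let G := index_set k (sys_D sys) `|` index_set k (sys_E sys) in
  F !=set0 ->
  exists2 C : R, 1 <= C & forall x y : int -> R, nonneg_solution k sys x y ->
    (forall n : nat, (1 <= n)%N -> comparable K (x n%:Z) (y n%:Z)) ->
    forall n : nat, (k < n)%N -> d <= y_den k sys x y n ->
    exists i, [/\ F i, 1 + y n%:Z <= C * (1 + y (n - i)%N%:Z)
      & forall j, G j ->
          y n%:Z * (1 + y (n - j)%N%:Z) <= C * (1 + y (n - i)%N%:Z)].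
Proof.
move=> K0 dp par F G Fn0.
have [[a0 A0 p0 q0] [[b0 c0 B0 C0] [d0 e0 D0 E0]]] := par.
have Fk : F `<=` [set i | (1 <= i <= k)%N] by move=> i [] [].
(* Auxiliary coefficients: 0 and 1 turn the dominating form into [1 + t], while the indicator of [G]
   isolates [t] at the lags in [G]. *)
have z0 : nonneg_family k (fun=> 0 : R) by [].
have o0 : nonneg_family k (fun=> 1 : R) by move=> i _; exact: ler01.
have g0 : nonneg_family k (fun j => `[< G j >]%:R : R) by move=> i _; exact: ler0n.
have [|H H0 HP] := family_dominated K0 ltr01 z0 o0 d0 e0.
  by move=> i /Fk ik; right; split.
(* The constant term is [d], because [sys_q sys] may be 0 and a positive one is required; this costs
   the factor 2 in [Q]. *)
have [|H' H'0 H'P] := family_dominated K0 dp D0 E0 z0 g0.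
  move=> i [[_]|[_]]; rewrite ?ltxx //.
  by case: asboolP => // _; rewrite ltxx.
pose P := sys_p sys + H * k%:R; pose Q := d^-1 + 2 * H'.
have P0 : 0 <= P by rewrite addr_ge0 // mulr_ge0.
have di0 : 0 <= d^-1 by rewrite invr_ge0 ltW.
have Q0 : 0 <= Q by rewrite addr_ge0 // mulr_ge0.
(* [P] bounds the numerator relative to [W], and [Q] bounds [1 + y (n - j)] relative to the
   denominator. Thus [1 + P / d] serves the growth bound and [P * Q] the product bound. *)
exists (1 + P / d + P * Q) => [|x y sol xy n kn dn].
  by rewrite -addrA lerDl addr_ge0 // mulr_ge0.
have [i Fi imax] := exists_max_on (fun i => 1 + y (n - i)%N%:Z) Fk Fn0.
exists i; set W := 1 + y (n - i)%N%:Z.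
have n1 : (1 <= n)%N by exact: leq_ltn_trans kn.
have yge0 m : (1 <= m)%N -> 0 <= y m%:Z by move/xy; case.
have W1 : 1 <= W by rewrite lerDl yge0 //; exact: lag_gt0 (Fk i Fi).
have W0 : 0 <= W by exact: le_trans W1.
have den0 : 0 < y_den k sys x y n by exact: lt_le_trans dn.
have numW : y_num k sys x y n <= P * W.
  apply: le_trans (affine_form_le (H := H) (W := W) _ kn _) _.
    move=> j jk; have [Fj|nFj] := pselect (F j).
      apply: le_trans (HP j jk _ _ (xy _ (lag_gt0 kn jk))) _.
      by rewrite mul0r addr0 mul1r ler_wpM2l // imax.
    have -> : sys_delta sys j = 0.
      apply/le_anti; rewrite d0 // andbT leNgt; apply/negP => ?.
      by apply: nFj; left.
    have -> : sys_epsilon sys j = 0.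
      apply/le_anti; rewrite e0 // andbT leNgt; apply/negP => ?.
      by apply: nFj; right.
    by rewrite !mul0r addr0 mulr_ge0.
  by rewrite /P mulrDl lerD2r ler_peMr.
have yden : y n%:Z * y_den k sys x y n = y_num k sys x y n.
  have [_ _ _ ->] := sol.2 n n1.
  by rewrite divfK // gt_eqF.
have yn0 : 0 <= y n%:Z by exact: yge0.
split=> //.
  have : y n%:Z <= P / d * W.
    rewrite mulrAC ler_pdivlMr //; apply: le_trans numW; rewrite -yden.
    exact: ler_wpM2l.
  have := mulr_ge0 (mulr_ge0 P0 Q0) W0; lra.
move=> j Gj; have jk : (1 <= j <= k)%N by case: Gj => -[].
have wQ : 1 + y (n - j)%N%:Z <= Q * y_den k sys x y n.
  have one : 1 <= d^-1 * y_den k sys x y n by rewrite mulrC ler_pdivlMr // mul1r.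
  have := H'P j jk _ _ (xy _ (lag_gt0 kn jk)); rewrite mul0r add0r asboolT // mul1r => yj.
  have := affine_form_ge_term xy (sys_q sys) D0 E0 kn jk.
  rewrite -/(y_den k sys x y n) => term.
  have : d + sys_D sys j * x (n - j)%N%:Z + sys_E sys j * y (n - j)%N%:Z
      <= 2 * y_den k sys x y n by lra.
  move=> /(ler_wpM2l H'0); rewrite /Q; lra.
(* Bounding the second factor by [Q] times the denominator turns the product into [Q] times the
   numerator. *)
apply: (@le_trans _ _ (P * Q * W)).
  apply: le_trans (ler_wpM2l yn0 wQ) _.
  by rewrite mulrCA yden [P * Q]mulrC -mulrA ler_wpM2l.
have := mulr_ge0 (mulr_ge0 P0 di0) W0; lra.
Qed.

(** * Assembly of the uniform eventual bound *)

Theorem theorem23 (R : realType) (k : nat) (sys : rational_system R)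
  (k_gt0 : (0 < k)%N)
  (sys_ge0 : nonneg_parameters k sys)
  (xy_comparable : exists M1 M2 M3 M4 : R,
     [/\ 0 < M1, 0 < M3, 0 < M2 & M2 < M4] /\
     forall x y : int -> R, nonneg_solution k sys x y ->
       forall n : nat, (1 <= n)%N ->
         x n%:Z <= M1 * y n%:Z + M2 /\
         M1 * y n%:Z + M2 <= M3 * x n%:Z + M4)
  (q_eq0 : sys_q sys = 0)
  (cases :
     [/\ index_set k (sys_B sys) `|` index_set k (sys_C sys)
           `<=` index_set k (sys_beta sys) `|` index_set k (sys_gamma sys),
         0 < sys_alpha sys
       & index_set k (sys_D sys) !=set0]
     \/
     [/\ index_set k (sys_D sys) `|` index_set k (sys_E sys)
           `<=` index_set k (sys_delta sys) `|` index_set k (sys_epsilon sys),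
         0 < sys_p sys
       & index_set k (sys_E sys) !=set0])
  (iteration : exists2 eta : nat, (0 < eta)%N &
     forall c : nat -> nat,
       (forall m : nat, (1 <= m)%N ->
          (index_set k (sys_delta sys) `|` index_set k (sys_epsilon sys)) (c m)) ->
       exists N1 N2 : nat,
         [/\ (1 <= N1 <= eta)%N, (1 <= N2 <= eta)%N
           & (index_set k (sys_D sys) `|` index_set k (sys_E sys))
               (\sum_(N1 <= m < N2.+1) c m)%N]) :
  exists (M : R) (N : nat),
    [/\ 0 < M, (1 <= N)%N
      & forall x y : int -> R, nonneg_solution k sys x y ->
          forall n : nat, (N < n)%N -> x n%:Z <= M /\ y n%:Z <= M].
Proof.
have [M1 [M2 [M3 [M4 [[M10 M30 M20 M24] cmp]]]]] := xy_comparable.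
have [eta _ iter] := iteration.
pose K := M1 + M2 + (M3 + M4) / M1.
have K0 : 0 <= K.
  by rewrite addr_ge0 ?divr_ge0 ?addr_ge0 // ltW // (lt_trans M20).
have xyK x y : nonneg_solution k sys x y ->
    forall n : nat, (1 <= n)%N -> comparable K (x n%:Z) (y n%:Z).
  move=> sol n n1; have [x0 y0 _ _] := nonneg_solution_pos sys_ge0 sol n1.
  by have [? ?] := cmp x y sol n n1; apply: comparable_of_affine.
have [d d0 dP] := y_den_lower_bound K0 sys_ge0 cases.
(* A bound on [y] suffices, as [x] is at most [M1 * y + M2]. *)
suff [M [N [M0 yM]]] : exists (M : R) (N : nat), 0 <= M /\
    forall x y, nonneg_solution k sys x y ->
    forall n : nat, (N < n)%N -> y n%:Z <= M.
  exists (M1 * M + M2 + M), N.+1; split=> //.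
    by rewrite ltr_wpDr // ltr_wpDl // mulr_ge0 // ltW.
  move=> x y sol n Nn; have yn : y n%:Z <= M by apply: yM sol _ _; lia.
  have [|xn _] := cmp x y sol n; first lia.
  have : M1 * y n%:Z <= M1 * M by rewrite ler_pM2l.
  have : 0 <= M1 * M by rewrite mulr_ge0 // ltW.
  by split; lra.
set F := index_set k (sys_delta sys) `|` index_set k (sys_epsilon sys) in iter.
have [[a0 A0 p0 q0] [[b0 c0 B0 C0] [de0 e0 D0 E0]]] := sys_ge0.
(* Without lags in [F] there is nothing to iterate: the numerator of [y] reduces to [sys_p sys] and
   its denominator is at least [d]. *)
have [F0|/set0P Fn0] := eqVneq F set0.
  exists (sys_p sys / d), (2 * k)%N; split=> [|x y sol n kn].
    by rewrite divr_ge0 // ltW.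
  have k_n : (k < n)%N by exact: leq_ltn_trans (leq_pmull k _) kn.
  have dn := dP x y sol (xyK x y sol) n kn.
  have [_ _ _ ->] := sol.2 n (leq_ltn_trans (leq0n k) k_n).
  have -> : y_num k sys x y n = sys_p sys.
    rewrite /y_num affine_formE //.
    rewrite big_nat_cond big1 ?addr0 // => i; rewrite andbT => ik.
    have nF : ~ F i by rewrite F0.
    have -> : sys_delta sys i = 0.
      apply/le_anti; rewrite de0 // andbT leNgt; apply/negP => ?.
      by apply: nF; left.
    have -> : sys_epsilon sys i = 0.
      apply/le_anti; rewrite e0 // andbT leNgt; apply/negP => ?.
      by apply: nF; right.
    by rewrite !mul0r addr0.
  by rewrite ler_wpM2l // lef_pV2 // posrE (lt_le_trans d0).
have [C C1 CP] := y_growth_step K0 d0 sys_ge0 Fn0.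
have Ce : 0 <= C ^+ eta by rewrite exprn_ge0 // (le_trans _ C1).
(* The iteration starts from [n0 = 2 * k], beyond which the denominator bound holds. *)
exists (C ^+ eta * (1 + C ^+ eta)), (2 * k + k * eta.+1)%N.
split=> [|x y sol n nn]; first by rewrite mulr_ge0 ?addr_ge0.
have := @bounded_by_iteration R k eta (2 * k) C F
  (index_set k (sys_D sys) `|` index_set k (sys_E sys)) (fun m => y m%:Z).
move=> /(_ _ _ Fn0 C1 iter _ _ n nn) b.
suff : 1 + y n%:Z <= C ^+ eta * (1 + C ^+ eta) by lra.
apply: b => [i [] []|i [] []|m mk|m mk] //.
  by have [] := xyK x y sol m (leq_ltn_trans (leq0n _) mk).
have k2m : (2 * k < m)%N by exact: leq_ltn_trans (leq_addr _ _) mk.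
have k_m : (k < m)%N by exact: leq_ltn_trans (leq_pmull k _) k2m.
exact: CP x y sol (xyK x y sol) m k_m (dP x y sol (xyK x y sol) m k2m).
Qed.
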